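(* Let $p,a\in\mathbb{S}$ take values in $[\nu,\nu^{-1}]$ for some $\nu\in(0,1]$, let $b:=a'$, let $v\in\mathbb{S}$ be the strictly positive solution of $(pv)'+(av')'=0$ with $\int_0^1v\,dx=1$, and suppose that $b^0:=\int_0^1 b\,v\,dx\neq0$. For $\varepsilon>0$ let $$L^{\varepsilon}u:=-p^{\varepsilon}u_t+(a^{\varepsilon}u_x)_x,\qquad p^{\varepsilon}(t,x):=p(\varepsilon^{-2}t+\varepsilon^{-1}x),\quad a^{\varepsilon}(t,x):=a(\varepsilon^{-2}t+\varepsilon^{-1}x),\qquad (t,x)\in\mathbb{R}^2.$$ Then the following statements hold. (I) For arbitrary $Y=(s,y)\in\mathbb{R}^2$, $r>0$ and $\delta\in(0,1)$, there are solutions $u^{\varepsilon}$ (for some $\varepsilon>0$) to the equation $L^{\varepsilon}u^{\varepsilon}=0$ in $C_r(Y)$ satisfying $$\operatorname*{osc}_{C_{\delta r}(Y)}u^{\varepsilon}\ge(1-\delta)\cdot\operatorname*{osc}_{C_r(Y)}u^{\varepsilon}.$$ In particular, there is no Hölder estimate with exponent independent of $\varepsilon$: there is no constant $\alpha>0$ independent of $\varepsilon>0$ such that, for all $\varepsilon>0$, all bounded solutions $u$ of $L^{\varepsilon}u=0$ in $C_r(Y)$ satisfy $$\operatorname*{osc}_{C_\rho(Y)}u\le\Big(\frac{2\rho}{r}\Big)^{\alpha}\operatorname*{osc}_{C_r(Y)}u\quad\text{for }0<\rho\le r.$$ (II) For arbitrary $Y=(s,y)\in\mathbb{R}^2$,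 $r>0$ and $\delta\in(0,1)$, there are solutions $u^{\varepsilon}$ (for some $\varepsilon>0$) to the equation $L^{\varepsilon}u^{\varepsilon}=0$ in $C_{2r}(Y)$ satisfying $0\le u^{\varepsilon}\le1$ in $C_{2r}(Y)$, $$\sup_{C_r(Y)}u^{\varepsilon}\le\delta,\qquad\text{and}\qquad \sup_{C_r(Y_r)}u^{\varepsilon}\ge1-\delta,\qquad\text{where }Y_r:=(s-2r^2,y).$$ In particular, there is no Harnack inequality with constant independent of $\varepsilon$: there is no constant $N>1$ independent of $\varepsilon>0$ such that, for all $\varepsilon>0$, all non-negative solutions $u$ of $L^{\varepsilon}u=0$ in $C_{2r}(Y)$ satisfy $$\sup_{C_r(Y_r)}u\le N\cdot\inf_{C_r(Y)}u.$$
   Context: $\mathbb{S}$ is the set of all smooth $1$-periodic functions on $\mathbb{R}$. Such a solution $v\in\mathbb{S}$ of $(pv)'+(av')'=0$ with $\int_0^1v\,dx=1$ exists, is unique, and is strictly positive. For $Y=(s,y)\in\mathbb{R}\times\mathbb{R}$ and $r>0$, $C_r(Y):=(s-r^2,s)\times(y-r,y+r)$, where the first coordinate is time $t$ and the second is $x$. $\operatorname{osc}_{C}u:=\sup_Cu-\inf_Cu$. Subscripts $t,x$ denote partial derivatives, and solutions are understood in the classical sense. *)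

(* Defs.v *)
From Stdlib Require Import Reals.
From Coquelicot Require Import Coquelicot.
Open Scope R_scope.

Definition smooth_periodic (f : R -> R) : Prop :=
  (forall (n : nat) (x : R), ex_derive_n f n x) /\
  (forall x : R, f (x + 1) = f x).

(* The parabolic cylinder C_r(s,y); the first coordinate is time. *)
Definition cyl (r s y : R) (t x : R) : Prop :=
  s - r ^ 2 < t < s /\ y - r < x < y + r.

(* Suprema and infima are taken in the extended reals, so no convention is
   needed for functions that are unbounded on C.  When C is nonempty the
   difference below is never of the form (+oo) - (+oo). *)
Definition sup_on (C : R -> R -> Prop) (u : R -> R -> R) : Rbar :=
  Lub_Rbar (fun z => exists t x, C t x /\ z = u t x).

Definition inf_on (C : R -> R -> Prop) (u : R -> R -> R) : Rbar :=
  Glb_Rbar (fun z => exists t x, C t x /\ z = u t x).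

Definition osc (C : R -> R -> Prop) (u : R -> R -> R) : Rbar :=
  Rbar_minus (sup_on C u) (inf_on C u).

Definition bounded_on (C : R -> R -> Prop) (u : R -> R -> R) : Prop :=
  exists M : R, forall t x, C t x -> Rabs (u t x) <= M.

Definition rescale (f : R -> R) (eps : R) (t x : R) : R :=
  f (t / eps ^ 2 + x / eps).

Definition dt (u : R -> R -> R) (t x : R) : R := Derive (fun t' => u t' x) t.
Definition dx (u : R -> R -> R) (t x : R) : R := Derive (fun x' => u t x') x.

Definition C12_on (C : R -> R -> Prop) (u : R -> R -> R) : Prop :=
  forall t x, C t x ->
    ex_derive (fun t' => u t' x) t /\
    ex_derive (fun x' => u t x') x /\
    ex_derive (fun x' => dx u t x') x /\
    continuity_2d_pt (dt u) t x /\
    continuity_2d_pt (dx u) t x /\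
    continuity_2d_pt (dx (dx u)) t x.

Definition L (p a : R -> R) (eps : R) (u : R -> R -> R) (t x : R) : R :=
  - rescale p eps t x * dt u t x
  + dx (fun t' x' => rescale a eps t' x' * dx u t' x') t x.

Definition solution (p a : R -> R) (eps : R)
    (C : R -> R -> Prop) (u : R -> R -> R) : Prop :=
  C12_on C u /\ forall t x, C t x -> L p a eps u t x = 0.

(* Main.v *)
(** As [eps] tends to 0, arbitrary functions [g(t)] of time alone are limits of solutions:
    the drift carries profiles through the cylinder at speed [b0 / eps], so a solution that
    varies on unit time scale is almost constant in [x].  For polynomial [g] this can be done
    with exact solutions.  With [X = x / eps] and [z = t / eps^2 + x / eps], one corrects [g]
    by finitely many terms [h(t) X^i psi(z)] with [psi] periodic, each obtained from a cell
    problem [(a psi')' - p psi' = f] that is solvable when [f] is orthogonal to [v]; this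
    orthogonality is achieved with an additional term [k h(t) X^(i+1)] because [b0 <> 0].
    The sum of the corrections is O(eps) on bounded sets.  For (I) take a high power of an
    affine function that is 1 at the final time, and for (II) a high power of a parabola
    in [t] that peaks at the final time [s - 2 r^2] of the earlier cylinder. *)

Require Import Defs.
From Stdlib Require Import Reals Arith Lra Lia FunctionalExtensionality.
From Coquelicot Require Import Coquelicot.
Open Scope R_scope.

(** * Periodic linear equations *)

Definition cont (f : R -> R) : Prop := forall x, continuous f x.
Definition periodic (f : R -> R) : Prop := forall x, f (x + 1) = f x.

Lemma cont_const (c : R) : cont (fun _ => c).
Proof. intro x; apply continuous_const. Qed.

Lemma cont_plus (f g : R -> R) : cont f -> cont g -> cont (fun x => f x + g x).
Proof. intros hf hg x; exact (continuous_plus f g x (hf x) (hg x)). Qed.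

Lemma cont_minus (f g : R -> R) : cont f -> cont g -> cont (fun x => f x - g x).
Proof. intros hf hg x; exact (continuous_minus f g x (hf x) (hg x)). Qed.

Lemma cont_opp (f : R -> R) : cont f -> cont (fun x => - f x).
Proof. intros hf x; exact (continuous_opp f x (hf x)). Qed.

Lemma cont_mult (f g : R -> R) : cont f -> cont g -> cont (fun x => f x * g x).
Proof. intros hf hg x; exact (continuous_mult f g x (hf x) (hg x)). Qed.

Lemma cont_div (f g : R -> R) :
  cont f -> cont g -> (forall x, g x <> 0) -> cont (fun x => f x / g x).
Proof.
  intros hf hg hn; apply cont_mult; [exact hf|].
  intro x; apply continuous_Rinv_comp; [apply hg | apply hn].
Qed.

Lemma cont_derivable (f df : R -> R) : (forall x, is_derive f x (df x)) -> cont f.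
Proof. intros h x; apply (ex_derive_continuous (K := R_AbsRing) (V := R_NormedModule)); exists (df x); apply h. Qed.

Ltac solve_cont :=
  lazymatch goal with
  | |- cont (fun x => @?f x + @?g x) => apply (cont_plus f g); solve_cont
  | |- cont (fun x => @?f x - @?g x) => apply (cont_minus f g); solve_cont
  | |- cont (fun x => - @?f x) => apply (cont_opp f); solve_cont
  | |- cont (fun x => @?f x * @?g x) => apply (cont_mult f g); solve_cont
  | |- cont (fun x => @?f x / @?g x) => apply (cont_div f g); [solve_cont | solve_cont | auto]
  | |- cont (fun _ => ?c) => apply (cont_const c)
  | _ => assumption
  end.

Lemma cont_ex_RInt (f : R -> R) (x y : R) : cont f -> ex_RInt f x y.
Proof. intro h; apply (@ex_RInt_continuous R_CompleteNormedModule); intros; apply h. Qed.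

Lemma const_derive (c x : R) : is_derive (fun _ : R => c) x 0.
Proof. exact (is_derive_const (K := R_AbsRing) (V := R_NormedModule) c x). Qed.

Lemma is_derive_primitive (f : R -> R) (x : R) :
  cont f -> is_derive (fun y => RInt f 0 y) x (f x).
Proof.
  intro h; apply (is_derive_RInt (V := R_NormedModule) f _ 0 x); [|apply h].
  exists (mkposreal 1 Rlt_0_1); intros y _.
  apply (@RInt_correct R_CompleteNormedModule), cont_ex_RInt, h.
Qed.

Lemma RInt_of_derive (f df : R -> R) (x y : R) :
  (forall z, is_derive f z (df z)) -> cont df -> RInt df x y = f y - f x.
Proof.
  intros hd hc; apply is_RInt_unique.
  apply (is_RInt_derive (V := R_CompleteNormedModule) f df); intros; auto.
Qed.

Lemma derive_zero_eq (f : R -> R) (x y : R) :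
  (forall z, is_derive f z 0) -> f x = f y.
Proof.
  intro h.
  assert (E : RInt (fun _ => 0) x y = f y - f x)
    by (apply RInt_of_derive; [exact h | apply cont_const]).
  rewrite RInt_const in E; unfold scal in E; simpl in E; unfold mult in E; simpl in E; lra.
Qed.

Lemma is_derive_shift (f : R -> R) (c x l : R) :
  is_derive f (x + c) l -> is_derive (fun y => f (y + c)) x l.
Proof.
  intro h; evar_last.
  - apply (is_derive_comp f (fun y => y + c)); [exact h|].
    auto_derive; [trivial | reflexivity].
  - simpl; unfold scal; simpl; unfold mult; simpl; ring.
Qed.

Lemma periodic_of_derive (f df : R -> R) :
  (forall x, is_derive f x (df x)) -> periodic f -> periodic df.
Proof.
  intros h hf x.
  rewrite <- (is_derive_unique _ _ _ (h x)).
  symmetry; apply is_derive_unique.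
  apply (is_derive_ext (fun y => f (y + 1))); [exact hf|].
  apply is_derive_shift, h.
Qed.

Lemma periodic_primitive (f : R -> R) :
  cont f -> periodic f -> RInt f 0 1 = 0 -> periodic (fun x => RInt f 0 x).
Proof.
  intros hc hp h0 x.
  (* The increment of the primitive over a unit interval has derivative [f (z + 1) - f z = 0], so it
     equals its value at [z = 0], which is the mean of [f]. *)
  assert (E : RInt f 0 (x + 1) - RInt f 0 x = RInt f 0 (0 + 1) - RInt f 0 0).
  { apply (derive_zero_eq (fun z => RInt f 0 (z + 1) - RInt f 0 z)); intro z.
    evar_last.
    - apply (is_derive_minus (fun z => RInt f 0 (z + 1)) (fun z => RInt f 0 z)).
      + apply (is_derive_shift (fun z => RInt f 0 z)), is_derive_primitive, hc.
      + apply is_derive_primitive, hc.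
    - rewrite hp; unfold minus, plus, opp; simpl; ring. }
  rewrite RInt_point, Rplus_0_l, h0 in E; unfold zero in E; simpl in E; lra.
Qed.

Lemma periodic_nat (f : R -> R) (n : nat) (x : R) : periodic f -> f (x + INR n) = f x.
Proof.
  intro hf; induction n as [|n IH].
  - f_equal; simpl; ring.
  - rewrite S_INR, <- Rplus_assoc, hf; exact IH.
Qed.

Lemma cont_bounded (f : R -> R) (x y : R) :
  cont f -> exists M, 0 <= M /\ forall z, x <= z <= y -> Rabs (f z) <= M.
Proof.
  intro hf.
  destruct (bounded_continuity (K := R_AbsRing) (V := R_NormedModule) f x y) as [M hM].
  { intros z _; apply hf. }
  exists (Rabs M); split; [apply Rabs_pos|]; intros z hz.
  specialize (hM z hz); unfold norm in hM; simpl in hM; unfold abs in hM; simpl in hM.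
  pose proof (Rle_abs M); lra.
Qed.

Lemma periodic_bounded (f : R -> R) :
  cont f -> periodic f -> exists M, 0 <= M /\ forall x, Rabs (f x) <= M.
Proof.
  intros hc hp; destruct (cont_bounded f 0 1 hc) as [M [hM0 hM]].
  exists M; split; [exact hM0|]; intro x.
  assert (H : forall y, 0 <= y -> Rabs (f y) <= M).
  { intros y hy; destruct (nfloor_ex y hy) as [n hn].
    replace y with (y - INR n + INR n) by ring.
    rewrite periodic_nat by exact hp; apply hM; lra. }
  destruct (Rle_dec 0 x) as [h|h]; [apply H, h|].
  destruct (nfloor_ex (- x)) as [n hn]; [lra|].
  (* Here [n] is the floor of [- x], so it takes [S n] periods to bring [x] to the nonnegative
     side. *)
  rewrite <- (periodic_nat f (S n) x hp); apply H; rewrite S_INR; lra.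
Qed.

(* The Floquet multiplier of [F' = c F] over a period is [exp (RInt c 0 1) <> 1], so the
   inhomogeneous equation has a periodic solution. *)
Lemma periodic_linear_ode (c f : R -> R) :
  cont c -> periodic c -> (forall x, 0 < c x) -> cont f -> periodic f ->
  exists F, (forall x, is_derive F x (c x * F x + f x)) /\ periodic F.
Proof.
  intros hc pc c0 hf pf.
  set (e := fun x => exp (RInt c 0 x)).
  assert (de : forall x, is_derive e x (c x * e x)).
  { intro x; apply (is_derive_comp exp (fun x => RInt c 0 x)).
    - apply is_derive_exp.
    - apply is_derive_primitive, hc. }
  assert (e0 : forall x, e x <> 0) by (intro x; unfold e; pose proof (exp_pos (RInt c 0 x)); lra).
  assert (e1 : 1 < e 1).
  { unfold e; rewrite <- exp_0 at 1; apply exp_increasing, RInt_gt_0; [lra | auto | intros; apply hc]. }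
  assert (e00 : e 0 = 1) by (unfold e; rewrite RInt_point; apply exp_0).
  assert (hfe : cont (fun x => f x / e x)).
  { apply cont_div; auto; apply (cont_derivable _ _ de). }
  set (J := fun x => RInt (fun x => f x / e x) 0 x).
  assert (dJ : forall x, is_derive J x (f x / e x)) by (intro x; exact (is_derive_primitive _ x hfe)).
  assert (J0 : J 0 = 0) by apply (@RInt_point R_CompleteNormedModule).
  clearbody e J.
  (* The initial value is found by solving [F 1 = F 0], that is [e 1 * (F0 + J 1) = F0]; this needs
     [e 1 <> 1]. *)
  set (F0 := e 1 * J 1 / (1 - e 1)).
  set (F := fun x => e x * (F0 + J x)).
  assert (dF : forall x, is_derive F x (c x * F x + f x)).
  { intro x; evar_last.
    - apply (is_derive_mult e (fun x => F0 + J x)); [apply de | | apply Rmult_comm].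
      apply (is_derive_plus (fun _ => F0) J); [apply is_derive_const | apply dJ].
    - unfold F, plus, mult, zero; simpl; field; apply e0. }
  exists F; split; [exact dF|]; intro x.
  (* By periodicity of [c] and [f], the difference [F (x + 1) - F x] solves the homogeneous
     equation, so it is a constant multiple of [e]; the choice of [F0] makes that constant zero. *)
  assert (E : (F (x + 1) - F x) / e x = (F (0 + 1) - F 0) / e 0).
  { apply (derive_zero_eq (fun z => (F (z + 1) - F z) / e z)); intro z.
    assert (dFs := is_derive_shift F 1 z _ (dF (z + 1))).
    evar_last.
    - apply (is_derive_div (fun z => F (z + 1) - F z) e).
      + apply (is_derive_minus (fun z => F (z + 1)) F); [exact dFs | apply dF].
      + apply de.
      + apply e0.
    - rewrite pc, pf; unfold minus, plus, opp; simpl; field; apply e0. }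
  replace (F (0 + 1) - F 0) with 0 in E.
  - replace (F (x + 1)) with ((F (x + 1) - F x) / e x * e x + F x) by (field; apply e0).
    rewrite E; unfold Rdiv; ring.
  - rewrite Rplus_0_l; unfold F; rewrite e00.
    rewrite J0; unfold F0; field; lra.
Qed.

(** * Cell problems and correctors *)

Section Correctors.

Variables p a da v dv : R -> R.
Variable C : R.
Hypothesis p_cont : cont p.
Hypothesis p_per : periodic p.
Hypothesis p_pos : forall x, 0 < p x.
Hypothesis a_der : forall x, is_derive a x (da x).
Hypothesis da_cont : cont da.
Hypothesis a_per : periodic a.
Hypothesis a_pos : forall x, 0 < a x.
Hypothesis v_der : forall x, is_derive v x (dv x).
Hypothesis v_per : periodic v.
Hypothesis v_pos : forall x, 0 < v x.
(** First integral of the equation for [v], with [C] the constant flux. *)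
Hypothesis v_flux : forall x, p x * v x + a x * dv x = C.
Hypothesis drift : RInt (fun x => da x * v x) 0 1 <> 0.

Let p_ne (x : R) : p x <> 0 := Rgt_not_eq _ _ (p_pos x).
Let a_ne (x : R) : a x <> 0 := Rgt_not_eq _ _ (a_pos x).
Let a_cont : cont a := cont_derivable _ _ a_der.
Let v_cont : cont v := cont_derivable _ _ v_der.
Let da_per : periodic da := periodic_of_derive _ _ a_der a_per.

(** With zero flux, [v' = - (p / a) v < 0], so [v] would be strictly decreasing, which periodicity
    forbids. *)
Lemma flux_neq_0 : C <> 0.
Proof.
  intro h.
  assert (E : forall x, dv x = - (p x / a x * v x)).
  { intro x; specialize (v_flux x); rewrite h in v_flux.
    apply (Rmult_eq_reg_l (a x)); [|apply a_ne].
    replace (a x * - (p x / a x * v x)) with (- (p x * v x)) by (field; apply a_ne); lra. }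
  assert (I : RInt (fun x => p x / a x * v x) 0 1 = - v 1 - - v 0).
  { apply (RInt_of_derive (fun x => - v x)); [|solve_cont; auto].
    intro z; evar_last; [apply (is_derive_opp v), v_der|].
    rewrite E; unfold opp; simpl; ring. }
  assert (P : 0 < RInt (fun x => p x / a x * v x) 0 1).
  { apply RInt_gt_0; [lra| |].
    - intros x _; apply Rmult_lt_0_compat; [|apply v_pos].
      apply Rdiv_lt_0_compat; [apply p_pos | apply a_pos].
    - intros x _; revert x; change (cont (fun x => p x / a x * v x)); solve_cont; auto. }
  pose proof (v_per 0) as Q; rewrite Rplus_0_l in Q; lra.
Qed.

(** The cell equation [(a psi')' - p psi' = f] with the divergence expanded. The term [- p psi'] is
    what the time derivative produces through the fast variable. *)
Record corrector (f psi dpsi ddpsi : R -> R) : Prop := {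
  corr_d : forall x, is_derive psi x (dpsi x);
  corr_dd : forall x, is_derive dpsi x (ddpsi x);
  corr_cont : cont ddpsi;
  corr_per : periodic psi;
  corr_eq : forall x, a x * ddpsi x + da x * dpsi x - p x * dpsi x = f x }.

(* With [F = a psi'], the flux identity turns the equation into
   [(v F)' = C psi' + v f]; integrating over a period shows that [psi'] has mean zero. *)
Lemma fredholm (f : R -> R) :
  cont f -> periodic f -> RInt (fun x => v x * f x) 0 1 = 0 ->
  exists psi dpsi ddpsi, corrector f psi dpsi ddpsi.
Proof.
  intros hf pf hint.
  (* In terms of [F = a psi'] the cell equation is the first-order equation [F' = (p / a) F + f]. *)
  destruct (periodic_linear_ode (fun x => p x / a x) f) as [F [dF pF]]; auto.
  { solve_cont; auto. }
  { intro x; rewrite p_per, a_per; reflexivity. }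
  { intro x; apply Rdiv_lt_0_compat; auto. }
  assert (cF : cont F) by apply (cont_derivable _ _ dF).
  assert (cFa : cont (fun x => F x / a x)) by (solve_cont; auto).
  assert (mean : RInt (fun x => F x / a x) 0 1 = 0).
  { assert (E : RInt (fun x => C * (F x / a x) + v x * f x) 0 1 = v 1 * F 1 - v 0 * F 0).
    { apply (RInt_of_derive (fun x => v x * F x)); [|solve_cont; auto].
      intro x; evar_last.
      - apply (is_derive_mult v F); [apply v_der | apply dF | apply Rmult_comm].
      - unfold plus, mult; simpl; rewrite <- (v_flux x); field; apply a_ne. }
    rewrite (RInt_plus (V := R_CompleteNormedModule) (fun x => C * (F x / a x)) (fun x => v x * f x)) in E
      by (apply cont_ex_RInt; solve_cont; auto).
    rewrite (RInt_scal (V := R_CompleteNormedModule) (fun x => F x / a x)) in E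
      by (apply cont_ex_RInt; auto).
    rewrite hint in E.
    pose proof (v_per 0) as Q; rewrite Rplus_0_l in Q.
    pose proof (pF 0) as Q'; rewrite Rplus_0_l in Q'.
    rewrite Q, Q' in E; unfold plus, scal, mult in E; simpl in E; unfold mult in E; simpl in E.
    apply (Rmult_eq_reg_l C); [|apply flux_neq_0]; lra. }
  (* The primitive of [F / a] is periodic because of [mean]; the last witness is the quotient rule
     for [F / a] with [F'] replaced through its equation. *)
  exists (fun x => RInt (fun x => F x / a x) 0 x), (fun x => F x / a x),
    (fun x => ((p x / a x * F x + f x) * a x - da x * F x) / a x ^ 2).
  split.
  - intro x; exact (is_derive_primitive _ x cFa).
  - intro x; evar_last; [apply is_derive_div; auto|]; simpl; field; apply a_ne.
  - apply cont_div; [solve_cont; auto | | intro x; apply pow_nonzero; auto].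
    unfold pow; solve_cont.
  - apply periodic_primitive; auto; intro x; rewrite pF, a_per; reflexivity.
  - intro x; field; apply a_ne.
Qed.

(** * Action of the operator on products of powers and periodic profiles *)

Definition mono (eps : R) (h : R -> R) (i : nat) (psi : R -> R) (t x : R) : R :=
  h t * (x / eps) ^ i * rescale psi eps t x.

(* [f] is [eps ^ 2 * L u], with the second-order term expanded. *)
Definition has_L (eps : R) (u f : R -> R -> R) : Prop :=
  exists ut ux uxx : R -> R -> R, forall t x,
    is_derive (fun t' => u t' x) t (ut t x) /\
    is_derive (u t) x (ux t x) /\
    is_derive (ux t) x (uxx t x) /\
    continuity_2d_pt ut t x /\ continuity_2d_pt ux t x /\ continuity_2d_pt uxx t x /\
    eps ^ 2 * (- rescale p eps t x * ut t x + rescale a eps t x * uxx t x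
               + / eps * rescale da eps t x * ux t x) = f t x.

Lemma has_L_ext (eps : R) (u f g : R -> R -> R) :
  (forall t x, f t x = g t x) -> has_L eps u f -> has_L eps u g.
Proof.
  intros E [ut [ux [uxx H]]]; exists ut, ux, uxx; intros t x; rewrite <- E; apply H.
Qed.

(* [repeat split] would also open the conjunction hidden in [is_derive]. *)
Ltac split7 := split; [|split; [|split; [|split; [|split; [|split]]]]].

Lemma has_L_const (eps c : R) : has_L eps (fun _ _ => c) (fun _ _ => 0).
Proof.
  exists (fun _ _ => 0), (fun _ _ => 0), (fun _ _ => 0); intros t x.
  split7; try apply const_derive; try apply continuity_2d_pt_const; ring.
Qed.

Lemma has_L_comb (eps c c' : R) (u f u' f' : R -> R -> R) :
  has_L eps u f -> has_L eps u' f' ->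
  has_L eps (fun t x => c * u t x + c' * u' t x) (fun t x => c * f t x + c' * f' t x).
Proof.
  intros [ut [ux [uxx H]]] [ut' [ux' [uxx' H']]].
  exists (fun t x => c * ut t x + c' * ut' t x), (fun t x => c * ux t x + c' * ux' t x),
    (fun t x => c * uxx t x + c' * uxx' t x); intros t x.
  destruct (H t x) as [H1 [H2 [H3 [H4 [H5 [H6 H7]]]]]].
  destruct (H' t x) as [H1' [H2' [H3' [H4' [H5' [H6' H7']]]]]].
  assert (D : forall (f g : R -> R) y l l', is_derive f y l -> is_derive g y l' ->
                is_derive (fun z => c * f z + c' * g z) y (c * l + c' * l')).
  { intros k g y l l' hk hg.
    apply (is_derive_plus (fun z => c * k z) (fun z => c' * g z)); apply is_derive_scal; assumption. }
  assert (K : forall f g, continuity_2d_pt f t x -> continuity_2d_pt g t x ->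
                continuity_2d_pt (fun t x => c * f t x + c' * g t x) t x).
  { intros; apply continuity_2d_pt_plus; apply continuity_2d_pt_mult; auto using continuity_2d_pt_const. }
  split7; auto.
  rewrite <- H7, <- H7'; ring.
Qed.

Lemma rescale_continuity_2d (psi : R -> R) (eps t x : R) :
  cont psi -> continuity_2d_pt (rescale psi eps) t x.
Proof.
  intro h; unfold rescale.
  apply (continuity_1d_2d_pt_comp psi (fun t x => t / eps ^ 2 + x / eps)).
  - apply continuity_pt_filterlim, h.
  - apply continuity_2d_pt_plus; apply continuity_2d_pt_mult;
      auto using continuity_2d_pt_const, continuity_2d_pt_id1, continuity_2d_pt_id2.
Qed.

Lemma mono_continuity_2d (eps : R) (h : R -> R) (i : nat) (psi : R -> R) (t x : R) :
  cont h -> cont psi -> continuity_2d_pt (mono eps h i psi) t x.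
Proof.
  intros hh hp; unfold mono.
  repeat apply continuity_2d_pt_mult.
  - apply (continuity_1d_2d_pt_comp h (fun t _ => t)); [apply continuity_pt_filterlim, hh|].
    apply continuity_2d_pt_id1.
  - apply (continuity_1d_2d_pt_comp (fun z => z ^ i) (fun _ x => x / eps)).
    + apply derivable_continuous_pt, derivable_pt_pow.
    + apply continuity_2d_pt_mult; auto using continuity_2d_pt_const, continuity_2d_pt_id2.
  - apply rescale_continuity_2d, hp.
Qed.

Lemma rescale_derive_t (psi dpsi : R -> R) (eps t x : R) :
  (forall z, is_derive psi z (dpsi z)) ->
  is_derive (fun t' => rescale psi eps t' x) t (/ eps ^ 2 * rescale dpsi eps t x).
Proof.
  intro h; apply (is_derive_comp psi (fun t' => t' / eps ^ 2 + x / eps)); [apply h|].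
  unfold Rdiv; auto_derive; [trivial | apply Rmult_1_l].
Qed.

Lemma rescale_derive_x (psi dpsi : R -> R) (eps t x : R) :
  (forall z, is_derive psi z (dpsi z)) ->
  is_derive (rescale psi eps t) x (/ eps * rescale dpsi eps t x).
Proof.
  intro h; apply (is_derive_comp psi (fun x' => t / eps ^ 2 + x' / eps)); [apply h|].
  unfold Rdiv; auto_derive; [trivial | ring].
Qed.

Lemma mono_derive_t (eps : R) (h dh : R -> R) (i : nat) (psi dpsi : R -> R) (t x : R) :
  (forall z, is_derive h z (dh z)) -> (forall z, is_derive psi z (dpsi z)) ->
  is_derive (fun t' => mono eps h i psi t' x) t
    (mono eps dh i psi t x + / eps ^ 2 * mono eps h i dpsi t x).
Proof.
  intros hh hp; unfold mono; evar_last.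
  - apply (is_derive_mult (fun t' => h t' * (x / eps) ^ i) (fun t' => rescale psi eps t' x)).
    + apply (is_derive_mult h (fun _ => (x / eps) ^ i));
        [apply hh | apply const_derive | apply Rmult_comm].
    + apply rescale_derive_t, hp.
    + apply Rmult_comm.
  - unfold plus, mult, zero; simpl; ring.
Qed.

Lemma mono_derive_x (eps : R) (h : R -> R) (i : nat) (psi dpsi : R -> R) (t x : R) :
  (forall z, is_derive psi z (dpsi z)) ->
  is_derive (mono eps h i psi t) x
    (INR i / eps * mono eps h (pred i) psi t x + / eps * mono eps h i dpsi t x).
Proof.
  intros hp; unfold mono; evar_last.
  - apply (is_derive_mult (fun x' => h t * (x' / eps) ^ i) (rescale psi eps t)).
    + apply (is_derive_scal (fun x' => (x' / eps) ^ i)).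
      apply (is_derive_pow (fun x' => x' / eps) i x (/ eps)).
      unfold Rdiv; auto_derive; [trivial | ring].
    + apply rescale_derive_x, hp.
    + apply Rmult_comm.
  - unfold plus, mult; simpl; unfold Rdiv; ring.
Qed.

(** The factor [eps ^ 2] in [has_L] cancels all negative powers of [eps] apart from those inside
    [x / eps]. The result is sorted by the power of [x / eps]: the cell operator keeps the degree,
    and each derivative that falls on the power lowers it by one. The truncation in [pred] is
    harmless, since the factors [INR i] and [INR (pred i)] vanish in those cases. *)
Lemma has_L_mono (eps : R) (h dh : R -> R) (i : nat) (psi dpsi ddpsi : R -> R) :
  0 < eps -> (forall z, is_derive h z (dh z)) -> cont dh ->
  (forall z, is_derive psi z (dpsi z)) -> (forall z, is_derive dpsi z (ddpsi z)) -> cont ddpsi ->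
  has_L eps (mono eps h i psi)
    (fun t x => - eps ^ 2 * mono eps dh i (fun z => p z * psi z) t x
      + mono eps h i (fun z => a z * ddpsi z + da z * dpsi z - p z * dpsi z) t x
      + INR i * mono eps h (pred i) (fun z => 2 * a z * dpsi z + da z * psi z) t x
      + INR i * INR (pred i) * mono eps h (pred (pred i)) (fun z => a z * psi z) t x).
Proof.
  intros he hh ch hp hdp cp.
  assert (ch0 := cont_derivable _ _ hh).
  assert (cp0 := cont_derivable _ _ hp).
  assert (cp1 := cont_derivable _ _ hdp).
  exists (fun t x => mono eps dh i psi t x + / eps ^ 2 * mono eps h i dpsi t x),
    (fun t x => INR i / eps * mono eps h (pred i) psi t x + / eps * mono eps h i dpsi t x),
    (fun t x => INR i / eps * (INR (pred i) / eps * mono eps h (pred (pred i)) psi t x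
                               + / eps * mono eps h (pred i) dpsi t x)
       + / eps * (INR i / eps * mono eps h (pred i) dpsi t x + / eps * mono eps h i ddpsi t x)).
  intros t x; split7.
  - apply mono_derive_t; assumption.
  - apply mono_derive_x; assumption.
  - apply (is_derive_plus (fun x => INR i / eps * mono eps h (pred i) psi t x)
             (fun x => / eps * mono eps h i dpsi t x));
      apply is_derive_scal, mono_derive_x; assumption.
  - repeat first [apply continuity_2d_pt_const | apply mono_continuity_2d; assumption
                 | apply continuity_2d_pt_plus | apply continuity_2d_pt_mult].
  - repeat first [apply continuity_2d_pt_const | apply mono_continuity_2d; assumption
                 | apply continuity_2d_pt_plus | apply continuity_2d_pt_mult].
  - repeat first [apply continuity_2d_pt_const | apply mono_continuity_2d; assumption
                 | apply continuity_2d_pt_plus | apply continuity_2d_pt_mult].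
  - unfold mono, rescale; field; lra.
Qed.

(** * Solvability with bounds in powers of 1/eps *)

Lemma mono_bounded (h : R -> R) (i : nat) (psi : R -> R) (K : R) :
  cont h -> cont psi -> periodic psi ->
  exists M, 0 <= M /\ forall eps t x, 0 < eps -> Rabs t <= K -> Rabs x <= K ->
    Rabs (mono eps h i psi t x) <= M * (/ eps) ^ i.
Proof.
  intros hh hp pp.
  destruct (cont_bounded h (- K) K hh) as [H [H0 hH]].
  destruct (periodic_bounded psi hp pp) as [P [P0 hP]].
  (* [Rabs K] keeps the constant nonnegative even when [K < 0] and the box is empty. *)
  exists (H * Rabs K ^ i * P).
  assert (K0 : 0 <= Rabs K ^ i) by apply pow_le, Rabs_pos.
  split; [repeat apply Rmult_le_pos; assumption|].
  intros eps t x he ht hx; unfold mono.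
  assert (e0 : 0 < / eps) by apply Rinv_0_lt_compat, he.
  rewrite !Rabs_mult.
  replace (H * Rabs K ^ i * P * (/ eps) ^ i) with (H * (Rabs K * / eps) ^ i * P)
    by (rewrite Rpow_mult_distr; ring).
  apply Rmult_le_compat; [| apply Rabs_pos | | apply hP].
  { apply Rmult_le_pos; apply Rabs_pos. }
  apply Rmult_le_compat; try apply Rabs_pos.
  - apply hH, Rabs_le_between, ht.
  - rewrite <- RPow_abs; apply pow_incr; split; [apply Rabs_pos|].
    unfold Rdiv; rewrite Rabs_mult, (Rabs_pos_eq (/ eps)) by lra.
    apply Rmult_le_compat_r; [lra|]; pose proof (Rle_abs K); lra.
Qed.

(** The equation holds on the whole plane, while the bound concerns the box of size [K]; [M] may
    depend on [K] but not on [eps]. Negative powers of [eps] must be allowed because [x / eps] is of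
    order [1 / eps] on the box. *)
Definition solvable (f : R -> R -> R -> R) (n : nat) : Prop :=
  forall K, exists M, 0 <= M /\ forall eps, 0 < eps <= 1 -> exists u, has_L eps u (f eps) /\
    forall t x, Rabs t <= K -> Rabs x <= K -> Rabs (u t x) <= M * (/ eps) ^ n.

Lemma solvable_ext (f g : R -> R -> R -> R) (n : nat) :
  (forall eps t x, 0 < eps -> f eps t x = g eps t x) -> solvable f n -> solvable g n.
Proof.
  intros E H K; destruct (H K) as [M [M0 HM]].
  exists M; split; [exact M0|]; intros eps he; destruct (HM eps he) as [u [Hu Bu]].
  exists u; split; [|exact Bu].
  apply has_L_ext with (f eps); [intros; apply E; lra | exact Hu].
Qed.

Lemma solvable_zero (n : nat) : solvable (fun _ _ _ => 0) n.
Proof.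
  intro K; exists 0; split; [lra|]; intros eps he.
  exists (fun _ _ => 0); split; [apply has_L_const|].
  intros; rewrite Rabs_R0; lra.
Qed.

Lemma solvable_plus (f g : R -> R -> R -> R) (n : nat) :
  solvable f n -> solvable g n -> solvable (fun eps t x => f eps t x + g eps t x) n.
Proof.
  intros Hf Hg K; destruct (Hf K) as [M [M0 HM]]; destruct (Hg K) as [N [N0 HN]].
  exists (M + N); split; [lra|]; intros eps he.
  destruct (HM eps he) as [u [Hu Bu]]; destruct (HN eps he) as [w [Hw Bw]].
  exists (fun t x => 1 * u t x + 1 * w t x); split.
  - apply has_L_ext with (fun t x => 1 * f eps t x + 1 * g eps t x); [intros; ring|].
    apply has_L_comb; assumption.
  - intros t x ht hx; specialize (Bu t x ht hx); specialize (Bw t x ht hx).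
    rewrite !Rmult_1_l; pose proof (Rabs_triang (u t x) (w t x)); lra.
Qed.

Lemma solvable_scal (c : R) (f : R -> R -> R -> R) (n : nat) :
  solvable f n -> solvable (fun eps t x => c * f eps t x) n.
Proof.
  intros Hf K; destruct (Hf K) as [M [M0 HM]].
  exists (Rabs c * M); split; [apply Rmult_le_pos; [apply Rabs_pos | exact M0]|]; intros eps he.
  destruct (HM eps he) as [u [Hu Bu]].
  exists (fun t x => c * u t x + 0 * 0); split.
  - apply has_L_ext with (fun t x => c * f eps t x + 0 * 0); [intros; ring|].
    apply (has_L_comb eps c 0 u (f eps) _ _ Hu (has_L_const eps 0)).
  - intros t x ht hx; specialize (Bu t x ht hx).
    rewrite Rmult_0_l, Rplus_0_r, Rabs_mult, Rmult_assoc.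
    apply Rmult_le_compat_l; [apply Rabs_pos | exact Bu].
Qed.

(** The factor [eps ^ 2] buys two powers of [1 / eps]. This pays for the terms in which a time
    derivative falls on [h], although these may have a higher degree in [x / eps]. *)
Lemma solvable_eps2 (f : R -> R -> R -> R) (n : nat) :
  solvable f (S (S n)) -> solvable (fun eps t x => eps ^ 2 * f eps t x) n.
Proof.
  intros Hf K; destruct (Hf K) as [M [M0 HM]].
  exists M; split; [exact M0|]; intros eps he; destruct (HM eps he) as [u [Hu Bu]].
  exists (fun t x => eps ^ 2 * u t x + 0 * 0); split.
  - apply has_L_ext with (fun t x => eps ^ 2 * f eps t x + 0 * 0); [intros; ring|].
    apply (has_L_comb eps (eps ^ 2) 0 u (f eps) _ _ Hu (has_L_const eps 0)).
  - intros t x ht hx; specialize (Bu t x ht hx).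
    rewrite Rmult_0_l, Rplus_0_r, Rabs_mult, (Rabs_pos_eq (eps ^ 2)) by apply pow2_ge_0.
    replace (M * (/ eps) ^ n) with (eps ^ 2 * (M * (/ eps) ^ (S (S n)))) by (simpl; field; lra).
    apply Rmult_le_compat_l; [apply pow2_ge_0 | exact Bu].
Qed.

Lemma solvable_weaken (f : R -> R -> R -> R) (n n' : nat) :
  (n <= n')%nat -> solvable f n -> solvable f n'.
Proof.
  intros hn Hf K; destruct (Hf K) as [M [M0 HM]].
  exists M; split; [exact M0|]; intros eps he; destruct (HM eps he) as [u [Hu Bu]].
  exists u; split; [exact Hu|]; intros t x ht hx.
  apply Rle_trans with (1 := Bu t x ht hx), Rmult_le_compat_l; [exact M0|].
  apply Rle_pow; [|exact hn].
  rewrite <- Rinv_1; apply Rinv_le_contravar; lra.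
Qed.

Lemma solvable_of_mono (h dh : R -> R) (i : nat) (psi dpsi ddpsi : R -> R) :
  (forall z, is_derive h z (dh z)) -> cont dh ->
  (forall z, is_derive psi z (dpsi z)) -> (forall z, is_derive dpsi z (ddpsi z)) -> cont ddpsi ->
  periodic psi ->
  solvable (fun eps t x => - eps ^ 2 * mono eps dh i (fun z => p z * psi z) t x
      + mono eps h i (fun z => a z * ddpsi z + da z * dpsi z - p z * dpsi z) t x
      + INR i * mono eps h (pred i) (fun z => 2 * a z * dpsi z + da z * psi z) t x
      + INR i * INR (pred i) * mono eps h (pred (pred i)) (fun z => a z * psi z) t x) i.
Proof.
  intros hh ch hp hdp cp pp K.
  destruct (mono_bounded h i psi K) as [M [M0 HM]]; auto.
  { apply (cont_derivable _ _ hh). }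
  { apply (cont_derivable _ _ hp). }
  exists M; split; [exact M0|]; intros eps he.
  exists (mono eps h i psi); split.
  - apply has_L_mono; auto; lra.
  - intros; apply HM; auto; lra.
Qed.

(** Polynomials of degree less than [m], encoded by the vanishing of the derivative of order [m]:
    the corrector construction differentiates in time and never needs coefficients. *)
Fixpoint poly_lt (m : nat) (h : R -> R) : Prop :=
  match m with
  | O => forall t, h t = 0
  | S m => exists dh, (forall t, is_derive h t (dh t)) /\ poly_lt m dh
  end.

Lemma poly_lt_cont (m : nat) (h : R -> R) : poly_lt m h -> cont h.
Proof.
  destruct m as [|m]; simpl.
  - intros H x; apply (continuous_ext (fun _ => 0)); [intro; symmetry; apply H|].
    apply continuous_const.
  - intros [dh [H _]]; apply (cont_derivable _ _ H).
Qed.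

Lemma poly_lt_S (m : nat) (h : R -> R) : poly_lt m h -> poly_lt (S m) h.
Proof.
  revert h; induction m as [|m IH]; intros h H.
  - exists (fun _ => 0); split; [|intro; reflexivity].
    intro t; apply (is_derive_ext (fun _ => 0)); [intro; symmetry; apply H|].
    apply const_derive.
  - destruct H as [dh [H1 H2]]; exists dh; auto.
Qed.

(* The leading term [h (k X^(d+1) + X^d psi)], with [X = x / eps], cancels [p h X^d q] up to
   terms of lower degree in [h] or in [X].  The constant [k] is what makes the cell problem
   for [psi] solvable; this is where the nonzero drift is needed. *)
Lemma right_inverse (m : nat) : forall (d : nat) (h q : R -> R),
  poly_lt m h -> cont q -> periodic q ->
  solvable (fun eps => mono eps h d (fun z => p z * q z)) (S d).
Proof.
  induction m as [|m IHm].
  { intros d h q hh _ _.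
    apply solvable_ext with (fun _ _ _ => 0); [|apply solvable_zero].
    intros eps t x _; unfold mono; rewrite hh; ring. }
  (* The induction is lexicographic: differentiating [h] lowers [m] but may raise [d], whereas at
     fixed [h] the remainders have degree [d - 1] and [d - 2]. *)
  induction d as [d IHd] using lt_wf_ind.
  intros h q hh cq pq.
  assert (hh0 := hh); destruct hh0 as [dh [dhh pdh]].
  assert (cdh := poly_lt_cont _ _ pdh).
  set (b0 := RInt (fun x => da x * v x) 0 1) in drift.
  assert (d0 : INR (S d) <> 0) by (apply not_0_INR; lia).
  (* Applied to [k h X^(d+1)], the operator yields the term [k (d+1) h X^d a']. This [k] makes
     [p q - k (d+1) a'] orthogonal to [v]. *)
  set (k := RInt (fun x => v x * (p x * q x)) 0 1 / (INR (S d) * b0)).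
  destruct (fredholm (fun x => p x * q x - k * INR (S d) * da x)) as [psi [dpsi [ddpsi Hpsi]]].
  { solve_cont. }
  { intro x; rewrite p_per, pq, da_per; reflexivity. }
  { rewrite (RInt_ext (V := R_CompleteNormedModule) _
      (fun x => minus (v x * (p x * q x)) (scal (k * INR (S d)) (da x * v x)))).
    2:{ intros; unfold minus, plus, opp, scal; simpl; unfold mult; simpl; ring. }
    rewrite (RInt_minus (V := R_CompleteNormedModule) (fun x => v x * (p x * q x))
               (fun x => scal (k * INR (S d)) (da x * v x))).
    2: apply cont_ex_RInt; solve_cont.
    2: apply (cont_ex_RInt (fun x => (k * INR (S d)) * (da x * v x))); solve_cont.
    rewrite (RInt_scal (V := R_CompleteNormedModule) (fun x => da x * v x))
      by (apply cont_ex_RInt; solve_cont).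
    fold b0; unfold k; revert d0; generalize (INR (S d)); intros D hD.
    unfold minus, plus, opp, scal; simpl; unfold mult; simpl; field.
    split; assumption. }
  destruct Hpsi as [D1 D2 D3 D4 D5].
  assert (cdpsi := cont_derivable _ _ D2).
  assert (cpsi := cont_derivable _ _ D1).
  assert (pdpsi := periodic_of_derive _ _ D1 D4).
  (* [q1] and [q2] collect, with reversed sign, the remainders of degree [d - 1] and [d - 2];
     dividing by [p] puts them in the form required by the induction hypothesis. *)
  set (q1 := fun z => - (k * INR (S d) * a z + 2 * a z * dpsi z + da z * psi z) / p z).
  set (q2 := fun z => - (a z * psi z) / p z).
  assert (A1 : solvable (fun eps t x => INR d * mono eps h (pred d) (fun z => p z * q1 z) t x) (S d)).
  { destruct d as [|d].
    - apply solvable_ext with (fun _ _ _ => 0); [intros; simpl; ring | apply solvable_zero].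
    - apply solvable_scal, solvable_weaken with (S d); [lia|].
      apply (IHd d); [lia | exact hh | unfold q1; solve_cont |].
      intro x; unfold q1; rewrite a_per, pdpsi, da_per, D4, p_per; reflexivity. }
  assert (A2 : solvable (fun eps t x => INR d * INR (pred d) *
                 mono eps h (pred (pred d)) (fun z => p z * q2 z) t x) (S d)).
  { destruct d as [|[|d]].
    - apply solvable_ext with (fun _ _ _ => 0); [intros; simpl; ring | apply solvable_zero].
    - apply solvable_ext with (fun _ _ _ => 0); [intros; simpl; ring | apply solvable_zero].
    - apply solvable_scal, solvable_weaken with (S d); [lia|].
      apply (IHd d); [lia | exact hh | unfold q2; solve_cont |].
      intro x; unfold q2; rewrite a_per, D4, p_per; reflexivity. }
  assert (B1 : solvable (fun eps t x => eps ^ 2 * mono eps dh d (fun z => p z * psi z) t x) (S d)).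
  { apply solvable_eps2, solvable_weaken with (S d); [lia|].
    apply IHm; assumption. }
  (* The degree rises to [S d] here, so [IHm] only gives the power [S (S d)]; the factor [eps ^ 2]
     more than compensates. *)
  assert (B2 : solvable (fun eps t x => k *
                 (eps ^ 2 * mono eps dh (S d) (fun z => p z * 1) t x)) (S d)).
  { apply solvable_scal, solvable_eps2, solvable_weaken with (S (S d)); [lia|].
    apply (IHm (S d) dh (fun _ => 1)); [exact pdh | apply cont_const | intro; reflexivity]. }
  assert (G1 := solvable_of_mono h dh d psi dpsi ddpsi dhh cdh D1 D2 D3 D4).
  assert (G2 := solvable_of_mono h dh (S d) (fun _ => 1) (fun _ => 0) (fun _ => 0) dhh cdh
    (fun z => const_derive 1 z) (fun z => const_derive 0 z) (cont_const 0) (fun z => eq_refl)).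
  apply (solvable_weaken _ d (S d)) in G1; [|lia].
  (* When these right-hand sides are added, everything cancels except [p h X^d q]. *)
  refine (solvable_ext _ _ _ _ (solvable_plus _ _ _ (solvable_plus _ _ _ A1 A2)
    (solvable_plus _ _ _ (solvable_plus _ _ _ B1 B2)
      (solvable_plus _ _ _ G1 (solvable_scal k _ _ G2))))).
  intros eps t x he; unfold mono; cbv beta.
  set (z := t / eps ^ 2 + x / eps).
  unfold rescale; fold z.
  pose proof (D5 z) as E.
  assert (E' : a z * ddpsi z + da z * dpsi z - p z * dpsi z
               = p z * q z - k * INR (S d) * da z) by exact E.
  rewrite E'; unfold q1, q2; simpl pred; field.
  auto.
Qed.

(** For [u = g] alone, [eps ^ 2 L u = - eps ^ 2 p g']. A function [w] with right-hand side [p g']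
    and size [O(1 / eps)] repairs this: [g + eps ^ 2 w] is an exact solution at distance [O(eps)]
    from [g]. *)
Lemma approximate_poly (m : nat) (g : R -> R) (K eta : R) :
  poly_lt m g -> 0 < eta ->
  exists eps u, 0 < eps /\ has_L eps u (fun _ _ => 0) /\
    forall t x, Rabs t <= K -> Rabs x <= K -> Rabs (u t x - g t) <= eta.
Proof.
  intros hg heta.
  (* Raising the degree bound provides a derivative even when [m = 0]. *)
  apply poly_lt_S in hg.
  destruct hg as [dg [D1 D2]].
  destruct (right_inverse m 0 dg (fun _ => 1) D2 (cont_const 1) (fun _ => eq_refl) K)
    as [M [M0 HM]].
  (* The error will be at most [M * eps]; [M + 1] avoids a division by zero when [M = 0]. *)
  set (eps := Rmin 1 (eta / (M + 1))).
  assert (he : 0 < eps <= 1).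
  { split; [apply Rmin_glb_lt; [lra | apply Rdiv_lt_0_compat; lra] | apply Rmin_l]. }
  destruct (HM eps he) as [w [Hw Bw]].
  exists eps, (fun t x => 1 * mono eps g 0 (fun _ => 1) t x + eps ^ 2 * w t x).
  split; [lra|]; split.
  - eapply has_L_ext; [|apply has_L_comb; [|exact Hw]].
    2: apply (has_L_mono eps g dg 0 (fun _ => 1) (fun _ => 0) (fun _ => 0));
         [lra | exact D1 | apply (poly_lt_cont _ _ D2) | intro; apply const_derive
         | intro; apply const_derive | apply cont_const].
    intros t x; unfold mono, rescale; simpl; ring.
  - intros t x ht hx; specialize (Bw t x ht hx).
    replace (1 * mono eps g 0 (fun _ => 1) t x + eps ^ 2 * w t x - g t) with (eps ^ 2 * w t x)
      by (unfold mono, rescale; simpl; ring).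
    rewrite Rabs_mult, (Rabs_pos_eq (eps ^ 2)) by apply pow2_ge_0.
    apply Rle_trans with (eps ^ 2 * (M * (/ eps) ^ 1)).
    { apply Rmult_le_compat_l; [apply pow2_ge_0 | exact Bw]. }
    replace (eps ^ 2 * (M * (/ eps) ^ 1)) with (M * eps) by (field; lra).
    apply Rle_trans with ((M + 1) * (eta / (M + 1))); [|right; field; lra].
    pose proof (Rmin_r 1 (eta / (M + 1))); fold eps in H.
    apply Rmult_le_compat; lra.
Qed.

Lemma has_L_solution (eps : R) (D : R -> R -> Prop) (u : R -> R -> R) :
  0 < eps -> has_L eps u (fun _ _ => 0) -> solution p a eps D u.
Proof.
  intros he [ut [ux [uxx H]]].
  (* Since the derivatives exist on the whole plane, these are equalities of functions, so the
     iterated [dx] can be rewritten too. *)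
  assert (Et : dt u = ut).
  { apply functional_extensionality; intro t; apply functional_extensionality; intro x.
    apply is_derive_unique, H. }
  assert (Ex : dx u = ux).
  { apply functional_extensionality; intro t; apply functional_extensionality; intro x.
    apply is_derive_unique, H. }
  assert (Exx : dx ux = uxx).
  { apply functional_extensionality; intro t; apply functional_extensionality; intro x.
    apply is_derive_unique, H. }
  split; intros t x _.
  - rewrite Et, Ex, Exx; destruct (H t x) as [H1 [H2 [H3 [H4 [H5 [H6 _]]]]]].
    split; [eexists; exact H1|]; split; [eexists; exact H2|]; split; [eexists; exact H3|].
    auto.
  - unfold L; rewrite Et, Ex.
    replace (dx (fun t' x' => rescale a eps t' x' * ux t' x') t x)
      with (/ eps * rescale da eps t x * ux t x + rescale a eps t x * uxx t x).
    + apply (Rmult_eq_reg_l (eps ^ 2)); [|apply pow_nonzero; lra].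
      rewrite Rmult_0_r; destruct (H t x) as [_ [_ [_ [_ [_ [_ H7]]]]]].
      rewrite <- H7; ring.
    + symmetry; apply is_derive_unique, (is_derive_mult (rescale a eps t) (ux t)).
      * apply rescale_derive_x, a_der.
      * apply H.
      * apply Rmult_comm.
Qed.

End Correctors.

(** * Polynomials in time and inequalities for powers *)

Lemma poly_lt_zero (m : nat) (h : R -> R) : (forall t, h t = 0) -> poly_lt m h.
Proof. intro H; induction m as [|m IH]; [exact H | apply poly_lt_S, IH]. Qed.

Lemma poly_lt_plus (m : nat) (f g : R -> R) :
  poly_lt m f -> poly_lt m g -> poly_lt m (fun t => f t + g t).
Proof.
  revert f g; induction m as [|m IH]; intros f g.
  - intros Hf Hg t; rewrite Hf, Hg; ring.
  - intros [df [Df Pf]] [dg [Dg Pg]]; exists (fun t => df t + dg t); split; [|auto].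
    intro t; apply (is_derive_plus f g); auto.
Qed.

(** Leibniz rule with a double induction: each of the two products in the derivative has one index
    lowered. *)
Lemma poly_lt_mult (m n : nat) (f g : R -> R) :
  poly_lt m f -> poly_lt n g -> poly_lt (m + n) (fun t => f t * g t).
Proof.
  revert n f g; induction m as [|m IHm]; intros n f g Hf Hg.
  { apply poly_lt_zero; intro t; rewrite Hf; ring. }
  revert f g Hf Hg; induction n as [|n IHn]; intros f g Hf Hg.
  { apply poly_lt_zero; intro t; rewrite Hg; ring. }
  assert (Hf0 := Hf); assert (Hg0 := Hg).
  destruct Hf0 as [df [Df Pf]]; destruct Hg0 as [dg [Dg Pg]].
  exists (fun t => df t * g t + f t * dg t); split.
  - intro t; apply (is_derive_mult f g); [apply Df | apply Dg | apply Rmult_comm].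
  - apply poly_lt_plus; [apply IHm; assumption|].
    replace (m + S n)%nat with (S m + n)%nat by lia; apply IHn; assumption.
Qed.

Lemma poly_lt_affine (c c' : R) : poly_lt 2 (fun t => c * t + c').
Proof.
  exists (fun _ => c); split.
  - intro t; auto_derive; [trivial | ring].
  - exists (fun _ => 0); split; [intro t; apply const_derive | intro t; reflexivity].
Qed.

Lemma poly_lt_pow (m : nat) (f : R -> R) (n : nat) :
  poly_lt m f -> exists k, poly_lt k (fun t => f t ^ n).
Proof.
  intro Hf; induction n as [|n [k IH]].
  - exists 1%nat, (fun _ => 0); split; [intro t; exact (const_derive 1 t) | intro t; reflexivity].
  - exists (m + k)%nat; apply (poly_lt_mult m k f (fun t => f t ^ n)); assumption.
Qed.

Lemma pow_small (q eta : R) : 0 <= q < 1 -> 0 < eta -> exists n, q ^ n <= eta.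
Proof.
  intros hq he.
  destruct (pow_lt_1_zero q) with (y := eta) as [n Hn]; [rewrite Rabs_pos_eq; lra | lra |].
  exists n; specialize (Hn n (le_n n)); rewrite Rabs_pos_eq in Hn; [lra|].
  apply pow_le; lra.
Qed.

(** The base is only bounded below by [1 - z], so that one inequality serves both the affine profile
    and the parabola, whose value near its peak is [1 - 4 z^2]. *)
Lemma bernoulli (q z : R) (n : nat) : 0 <= z <= 1 -> 1 - z <= q -> 1 - INR n * z <= q ^ n.
Proof.
  intros hz hq; apply Rle_trans with ((1 - z) ^ n); [|apply pow_incr; lra].
  clear q hq; induction n as [|n IH]; [simpl; lra|].
  rewrite S_INR; change ((1 - z) ^ S n) with ((1 - z) * (1 - z) ^ n).
  pose proof (pos_INR n); assert (0 <= (1 - z) * ((1 - z) ^ n - (1 - INR n * z)))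
    by (apply Rmult_le_pos; lra).
  nra.
Qed.

Lemma pow_le_1 (q : R) (n : nat) : 0 <= q <= 1 -> 0 <= q ^ n <= 1.
Proof.
  intro hq; split; [apply pow_le; lra|].
  rewrite <- (pow1 n); apply pow_incr; lra.
Qed.

(** * Oscillation and suprema on cylinders *)

Lemma sup_on_ge (D : R -> R -> Prop) (u : R -> R -> R) (t x : R) :
  D t x -> Rbar_le (u t x) (sup_on D u).
Proof. intro H; apply Lub_Rbar_correct; exists t, x; auto. Qed.

Lemma sup_on_le (D : R -> R -> Prop) (u : R -> R -> R) (M : R) :
  (forall t x, D t x -> u t x <= M) -> Rbar_le (sup_on D u) M.
Proof. intro H; apply Lub_Rbar_correct; intros z [t [x [h E]]]; rewrite E; apply H, h. Qed.

Lemma inf_on_le (D : R -> R -> Prop) (u : R -> R -> R) (t x : R) :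
  D t x -> Rbar_le (inf_on D u) (u t x).
Proof. intro H; apply Glb_Rbar_correct; exists t, x; auto. Qed.

Lemma inf_on_ge (D : R -> R -> Prop) (u : R -> R -> R) (m : R) :
  (forall t x, D t x -> m <= u t x) -> Rbar_le m (inf_on D u).
Proof. intro H; apply Glb_Rbar_correct; intros z [t [x [h E]]]; rewrite E; apply H, h. Qed.

(** Besides the two-sided bound, this makes the oscillation finite, so that later comparisons in
    [Rbar] become real inequalities. *)
Lemma osc_bounds (D : R -> R -> Prop) (u : R -> R -> R) (m M t1 x1 t2 x2 : R) :
  (forall t x, D t x -> m <= u t x <= M) -> D t1 x1 -> D t2 x2 ->
  exists o : R, osc D u = Finite o /\ u t1 x1 - u t2 x2 <= o <= M - m.
Proof.
  intros H H1 H2; unfold osc.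
  pose proof (sup_on_ge D u t1 x1 H1) as S1.
  pose proof (sup_on_le D u M (fun t x h => proj2 (H t x h))) as S2.
  pose proof (inf_on_le D u t2 x2 H2) as I1.
  pose proof (inf_on_ge D u m (fun t x h => proj1 (H t x h))) as I2.
  destruct (sup_on D u) as [S| |]; simpl in *; try contradiction.
  destruct (inf_on D u) as [I| |]; simpl in *; try contradiction.
  exists (S - I); split; [reflexivity | lra].
Qed.

Lemma cyl_mono (r r' s y t x : R) : 0 < r <= r' -> cyl r s y t x -> cyl r' s y t x.
Proof. unfold cyl; intros hr h; assert (r ^ 2 <= r' ^ 2) by nra; lra. Qed.

Lemma cyl_in_box (r s y t x : R) : 0 < r -> cyl r s y t x ->
  Rabs t <= Rabs s + r ^ 2 + Rabs y + r /\ Rabs x <= Rabs s + r ^ 2 + Rabs y + r.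
Proof.
  intros hr h; unfold cyl in h.
  pose proof (pow2_ge_0 r).
  pose proof (Rle_abs s); pose proof (Rle_abs y).
  pose proof (Rle_abs (- s)); pose proof (Rle_abs (- y)).
  rewrite Rabs_Ropp in *.
  split; apply Rabs_le; lra.
Qed.

(** All that the two constructions below need from the correctors. The affine images [c * u + c']
    are included so that a solution can be normalised to take values in [0,1]. *)
Definition poly_approximable (p a : R -> R) : Prop :=
  forall (m : nat) (g : R -> R) (K eta : R), poly_lt m g -> 0 < eta ->
  exists eps u, 0 < eps /\
    (forall (D : R -> R -> Prop) (c c' : R),
       solution p a eps D (fun t x => c * u t x + c')) /\
    (forall t x, Rabs t <= K -> Rabs x <= K -> Rabs (u t x - g t) <= eta).

(** * Approximability from nonzero drift *)

Lemma smooth_derive (f : R -> R) (x : R) : smooth_periodic f -> is_derive f x (Derive f x).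
Proof. intros [H _]; apply Derive_correct, (H 1%nat). Qed.

Lemma smooth_derive2 (f : R -> R) (x : R) :
  smooth_periodic f -> is_derive (Derive f) x (Derive (Derive f) x).
Proof. intros [H _]; apply Derive_correct, (H 2%nat). Qed.

Lemma nonzero_drift_approximable (nu : R) (p a v : R -> R) :
  0 < nu -> smooth_periodic p -> smooth_periodic a ->
  (forall x, nu <= p x) -> (forall x, nu <= a x) ->
  smooth_periodic v -> (forall x, 0 < v x) ->
  (forall x, Derive (fun z => p z * v z) x + Derive (fun z => a z * Derive v z) x = 0) ->
  RInt (fun x => Derive a x * v x) 0 1 <> 0 ->
  poly_approximable p a.
Proof.
  intros hnu hp ha hpb hab hv hv0 hveq hb m g K eta hg heta.
  (* Integrating the equation for [v] once gives a constant flux, evaluated here at 0. *)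
  assert (flux : forall x, p x * v x + a x * Derive v x = p 0 * v 0 + a 0 * Derive v 0).
  { intro x; apply (derive_zero_eq (fun z => p z * v z + a z * Derive v z)); intro z.
    rewrite <- (hveq z).
    assert (ex1 : ex_derive (fun z => p z * v z) z)
      by (apply ex_derive_mult; [exists (Derive p z) | exists (Derive v z)];
          apply smooth_derive; assumption).
    assert (ex2 : ex_derive (fun z => a z * Derive v z) z).
    { apply ex_derive_mult; [exists (Derive a z); apply smooth_derive, ha|].
      exists (Derive (Derive v) z); apply smooth_derive2, hv. }
    exact (is_derive_plus (fun z => p z * v z) (fun z => a z * Derive v z) z _ _
             (Derive_correct _ _ ex1) (Derive_correct _ _ ex2)). }
  destruct (approximate_poly p a (Derive a) v (Derive v) (p 0 * v 0 + a 0 * Derive v 0))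
    with (m := m) (g := g) (K := K) (eta := eta) as [eps [u [he [Hu Bu]]]].
  - apply (cont_derivable p (Derive p)); intro x; apply smooth_derive, hp.
  - exact (proj2 hp).
  - intro x; specialize (hpb x); lra.
  - intro x; apply smooth_derive, ha.
  - apply (cont_derivable _ (Derive (Derive a))); intro x; apply smooth_derive2, ha.
  - exact (proj2 ha).
  - intro x; specialize (hab x); lra.
  - intro x; apply smooth_derive, hv.
  - exact (proj2 hv).
  - exact hv0.
  - exact flux.
  - exact hb.
  - exact hg.
  - exact heta.
  - exists eps, u; split; [exact he|]; split; [|exact Bu].
    intros D c c'; apply has_L_solution with (da := Derive a).
    + intro x; apply smooth_derive, ha.
    + exact he.
    + replace (fun t x => c * u t x + c') with (fun t x => c * u t x + 1 * c').
      2:{ apply functional_extensionality; intro t; apply functional_extensionality; intro x; ring. }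
      apply has_L_ext with (fun t x => c * 0 + 1 * 0); [intros; ring|].
      apply (has_L_comb p a (Derive a) eps c 1 u (fun _ _ => 0) (fun _ _ => c') (fun _ _ => 0) Hu).
      apply has_L_const.
Qed.

(** The profile [l ^ n] climbs from almost 0 to 1 within the last [delta ^ 2 r ^ 2] units of time,
    so the small cylinder sees nearly all of the oscillation. Its strict positivity excludes
    constants, for which the inequality would be trivial. *)
Lemma oscillation_persists (p a : R -> R) (s y r delta : R) :
  poly_approximable p a -> 0 < r -> 0 < delta < 1 ->
  exists (eps : R) (u : R -> R -> R),
    0 < eps /\ solution p a eps (cyl r s y) u /\ bounded_on (cyl r s y) u /\
    Rbar_lt 0 (osc (cyl r s y) u) /\
    Rbar_le (Rbar_mult (1 - delta) (osc (cyl r s y) u)) (osc (cyl (delta * r) s y) u).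
Proof.
  intros happ hr hd.
  assert (r2 : 0 < r ^ 2) by (apply pow_lt, hr).
  assert (hd2 : 0 < delta ^ 2 < 1) by nra.
  set (eta := delta / 8).
  (* [1 - delta ^ 2 / 2] is the value of [l] at the middle time of the small cylinder. *)
  destruct (pow_small (1 - delta ^ 2 / 2) eta) as [n Hn]; [lra | unfold eta; lra |].
  set (l := fun t => / r ^ 2 * t + (1 - / r ^ 2 * s)).
  assert (El : forall z, l (s - z * r ^ 2) = 1 - z) by (intro z; unfold l; field; lra).
  destruct (poly_lt_pow 2 l n (poly_lt_affine _ _)) as [k Hk].
  destruct (happ k _ (Rabs s + r ^ 2 + Rabs y + r) eta Hk) as [eps [u [he [Hu Bu]]]].
  { unfold eta; lra. }
  assert (lt01 : forall t x, cyl r s y t x -> 0 <= l t <= 1).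
  { intros t x [h _]; replace t with (s - (s - t) / r ^ 2 * r ^ 2) by (field; lra).
    rewrite El.
    assert (0 < (s - t) / r ^ 2 < 1); [|lra].
    split; [apply Rdiv_lt_0_compat; lra | apply Rlt_div_l; lra]. }
  assert (ub : forall t x, cyl r s y t x -> - eta <= u t x <= 1 + eta).
  { intros t x h; destruct (cyl_in_box r s y t x hr h) as [ht hx].
    specialize (Bu t x ht hx); apply Rabs_le_between in Bu.
    pose proof (pow_le_1 (l t) n (lt01 t x h)); lra. }
  assert (hn := pos_INR n).
  (* A time so close to [s] that [INR n * z1 <= eta], hence [l ^ n >= 1 - eta], and still inside the
     small cylinder. *)
  set (z1 := eta * delta ^ 2 / (INR n + 1)).
  assert (ed : 0 < eta * delta ^ 2) by (apply Rmult_lt_0_compat; unfold eta; lra).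
  assert (ed' : eta * delta ^ 2 <= eta /\ eta * delta ^ 2 < delta ^ 2) by (unfold eta; nra).
  assert (z1E : (INR n + 1) * z1 = eta * delta ^ 2) by (unfold z1; field; lra).
  assert (z1pos : 0 < z1) by (apply Rdiv_lt_0_compat; lra).
  assert (P1 : cyl (delta * r) s y (s - z1 * r ^ 2) y).
  { unfold cyl; rewrite Rpow_mult_distr.
    assert (z1 < delta ^ 2) by nra; assert (0 < delta * r) by nra.
    assert (0 < z1 * r ^ 2 < delta ^ 2 * r ^ 2) by nra; lra. }
  assert (P2 : cyl (delta * r) s y (s - delta ^ 2 / 2 * r ^ 2) y).
  { unfold cyl; rewrite Rpow_mult_distr; assert (0 < delta * r) by nra.
    assert (0 < delta ^ 2 * r ^ 2) by nra; lra. }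
  assert (sub : forall t x, cyl (delta * r) s y t x -> cyl r s y t x)
    by (intros t x; apply cyl_mono; nra).
  assert (U1 : 1 - 2 * eta <= u (s - z1 * r ^ 2) y).
  { destruct (cyl_in_box _ _ _ _ _ hr (sub _ _ P1)) as [ht hx].
    specialize (Bu _ _ ht hx); apply Rabs_le_between in Bu; rewrite El in Bu.
    assert (1 - INR n * z1 <= (1 - z1) ^ n) by (apply bernoulli; nra); nra. }
  assert (U2 : u (s - delta ^ 2 / 2 * r ^ 2) y <= 2 * eta).
  { destruct (cyl_in_box _ _ _ _ _ hr (sub _ _ P2)) as [ht hx].
    specialize (Bu _ _ ht hx); apply Rabs_le_between in Bu; rewrite El in Bu; lra. }
  destruct (osc_bounds _ u _ _ _ _ _ _ ub (sub _ _ P1) (sub _ _ P2)) as [o [Eo Ho]].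
  destruct (osc_bounds (cyl (delta * r) s y) u _ _ _ _ _ _ (fun t x h => ub t x (sub t x h)) P1 P2)
    as [o' [Eo' Ho']].
  assert (Eu : (fun t x => 1 * u t x + 0) = u).
  { apply functional_extensionality; intro t; apply functional_extensionality; intro x; ring. }
  exists eps, u; split; [exact he|]; split; [rewrite <- Eu; apply Hu|]; split.
  - exists (1 + eta); intros t x h; apply Rabs_le; specialize (ub t x h); lra.
  (* The oscillations are at least [1 - 4 eta] and at most [1 + 2 eta]; with [delta = 8 eta],
     [(1 - 8 eta) (1 + 2 eta) <= 1 - 4 eta]. *)
  - rewrite Eo, Eo'; simpl; unfold eta in *; split; [lra | nra].
Qed.

Lemma front_passes (p a : R -> R) (s y r delta : R) :
  poly_approximable p a -> 0 < r -> 0 < delta < 1 ->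
  exists (eps : R) (u : R -> R -> R),
    0 < eps /\ solution p a eps (cyl (2 * r) s y) u /\
    (forall t x, cyl (2 * r) s y t x -> 0 <= u t x <= 1) /\
    Rbar_le (sup_on (cyl r s y) u) delta /\
    Rbar_le (1 - delta) (sup_on (cyl r (s - 2 * r ^ 2) y) u).
Proof.
  intros happ hr hd.
  assert (r2 : 0 < r ^ 2) by (apply pow_lt, hr).
  set (eta := delta / 4).
  assert (heta : 0 < eta < / 4) by (unfold eta; lra).
  destruct (pow_small (3 / 4) eta) as [n Hn]; [lra | lra |].
  (* With [t = s - 4 z r^2], [g = 4 z (1 - z)] peaks at [z = 1/2], and [g <= 3/4] for [z <= 1/4]. *)
  set (g := fun t => (/ r ^ 2 * s + - / r ^ 2 * t) * (1 - / (4 * r ^ 2) * s + / (4 * r ^ 2) * t)).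
  assert (Pg : poly_lt 4 g).
  { apply (poly_lt_mult 2 2 (fun t => / r ^ 2 * s + - / r ^ 2 * t)
             (fun t => 1 - / (4 * r ^ 2) * s + / (4 * r ^ 2) * t)).
    - replace (fun t => / r ^ 2 * s + - / r ^ 2 * t) with (fun t => - / r ^ 2 * t + / r ^ 2 * s)
        by (apply functional_extensionality; intro; ring).
      apply poly_lt_affine.
    - replace (fun t => 1 - / (4 * r ^ 2) * s + / (4 * r ^ 2) * t)
        with (fun t => / (4 * r ^ 2) * t + (1 - / (4 * r ^ 2) * s))
        by (apply functional_extensionality; intro; ring).
      apply poly_lt_affine. }
  assert (Eg : forall z, g (s - 4 * z * r ^ 2) = 4 * z * (1 - z)) by (intro z; unfold g; field; lra).
  assert (Et : forall t, t = s - 4 * ((s - t) / (4 * r ^ 2)) * r ^ 2) by (intro t; field; lra).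
  destruct (poly_lt_pow 4 g n Pg) as [k Hk].
  set (K := Rabs s + (2 * r) ^ 2 + Rabs y + 2 * r).
  destruct (happ k _ K eta Hk) as [eps [u [he [Hu Bu]]]]; [lra|].
  assert (box : forall t x, cyl (2 * r) s y t x -> - eta <= u t x - g t ^ n <= eta).
  { intros t x h; destruct (cyl_in_box (2 * r) s y t x) as [ht hx]; [lra | exact h |].
    apply Rabs_le_between, Bu; assumption. }
  (* Affine map taking [-eta, 1 + eta] onto [0,1]. *)
  set (w := fun t x => / (1 + 2 * eta) * u t x + eta / (1 + 2 * eta)).
  assert (wE : forall t x, (1 + 2 * eta) * w t x = u t x + eta) by (intros; unfold w; field; lra).
  exists eps, w; split; [exact he|]; split; [apply Hu|]; split; [|split].
  - intros t x h; specialize (box t x h); specialize (wE t x).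
    assert (0 <= g t <= 1).
    { rewrite (Et t), Eg; destruct h as [h _].
      assert (0 < (s - t) / (4 * r ^ 2) < 1).
      { split; [apply Rdiv_lt_0_compat; lra | apply Rlt_div_l; lra]. }
      set (z := (s - t) / (4 * r ^ 2)) in *; pose proof (pow2_ge_0 (1 - 2 * z)); nra. }
    pose proof (pow_le_1 (g t) n H); nra.
  - apply sup_on_le; intros t x h.
    specialize (box t x (cyl_mono r (2 * r) s y t x ltac:(lra) h)); specialize (wE t x).
    assert (0 <= g t <= 3 / 4).
    { rewrite (Et t), Eg; destruct h as [h _].
      assert (0 < (s - t) / (4 * r ^ 2) < / 4).
      { split; [apply Rdiv_lt_0_compat; lra | apply Rlt_div_l; lra]. }
      set (z := (s - t) / (4 * r ^ 2)) in *; nra. }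
    pose proof (pow_incr (g t) (3 / 4) n H); unfold eta in *; nra.
  - assert (hn := pos_INR n).
    (* The cylinder is open and misses the peak time, so [w] is evaluated slightly earlier, where
       the parabola is [1 - 4 z^2 >= 1 - z]. *)
    set (z := eta / (INR n + 1)).
    assert (zE : (INR n + 1) * z = eta) by (unfold z; field; lra).
    assert (z0 : 0 < z) by (apply Rdiv_lt_0_compat; lra).
    assert (z1 : z < / 4) by nra.
    assert (P : cyl r (s - 2 * r ^ 2) y (s - 4 * (/ 2 + z) * r ^ 2) y).
    { unfold cyl; assert (0 < z * r ^ 2 < / 4 * r ^ 2) by nra; lra. }
    apply Rbar_le_trans with (2 := sup_on_ge _ w _ _ P).
    change (1 - delta <= w (s - 4 * (/ 2 + z) * r ^ 2) y).
    assert (Q : cyl (2 * r) s y (s - 4 * (/ 2 + z) * r ^ 2) y) by (unfold cyl in *; nra).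
    specialize (box _ _ Q); specialize (wE (s - 4 * (/ 2 + z) * r ^ 2) y); rewrite Eg in box.
    assert (1 - INR n * z <= (4 * (/ 2 + z) * (1 - (/ 2 + z))) ^ n) by (apply bernoulli; nra).
    assert (INR n * z <= eta) by nra; assert (dE : delta = 4 * eta) by (unfold eta; lra).
    apply Rmult_le_reg_l with (1 + 2 * eta); [lra|]; rewrite wE, dE; nra.
Qed.

(** * Failure of uniform Hölder and Harnack estimates *)

Lemma no_uniform_holder (p a : R -> R) (s y r alpha : R) :
  poly_approximable p a -> 0 < r -> 0 < alpha ->
  ~ (forall (eps : R) (u : R -> R -> R), 0 < eps ->
       solution p a eps (cyl r s y) u -> bounded_on (cyl r s y) u ->
       forall rho : R, 0 < rho <= r ->
         Rbar_le (osc (cyl rho s y) u)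
                 (Rbar_mult (Rpower (2 * rho / r) alpha) (osc (cyl r s y) u))).
Proof.
  intros happ hr hal H.
  (* With [rho = delta * r] the Hölder factor is at most 1/2, while at least [1 - delta >= 3/4] of
     the positive oscillation persists. *)
  set (delta := Rmin (/ 4) (Rpower (/ 2) (/ alpha) / 2)).
  assert (hd : 0 < delta <= / 4).
  { split; [|apply Rmin_l]; apply Rmin_glb_lt; [lra|].
    apply Rdiv_lt_0_compat; [apply exp_pos | lra]. }
  assert (hpow : Rpower (2 * delta) alpha <= / 2).
  { apply Rle_trans with (Rpower (Rpower (/ 2) (/ alpha)) alpha).
    - apply Rle_Rpower_l; [lra|]; split; [lra|].
      pose proof (Rmin_r (/ 4) (Rpower (/ 2) (/ alpha) / 2)); fold delta in H0; lra.
    - rewrite Rpower_mult, Rinv_l, Rpower_1; lra. }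
  destruct (oscillation_persists p a s y r delta happ hr) as [eps [u [he [Hu [Bu [H0 H1]]]]]];
    [lra|].
  specialize (H eps u he Hu Bu (delta * r)).
  replace (2 * (delta * r) / r) with (2 * delta) in H by (field; lra).
  assert (H2 := Rbar_le_trans _ _ _ H1 (H ltac:(nra))).
  destruct Bu as [M HM].
  assert (P : cyl r s y (s - r ^ 2 / 2) y) by (unfold cyl; nra).
  destruct (osc_bounds (cyl r s y) u (- M) M _ _ _ _
    (fun t x h => proj1 (Rabs_le_between _ _) (HM t x h)) P P) as [o [Eo _]].
  rewrite Eo in H0, H2; simpl in H0, H2; nra.
Qed.

Lemma no_uniform_harnack (p a : R -> R) (s y r N : R) :
  poly_approximable p a -> 0 < r -> 1 < N ->
  ~ (forall (eps : R) (u : R -> R -> R), 0 < eps ->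
       solution p a eps (cyl (2 * r) s y) u ->
       (forall t x, cyl (2 * r) s y t x -> 0 <= u t x) ->
       Rbar_le (sup_on (cyl r (s - 2 * r ^ 2) y) u) (Rbar_mult N (inf_on (cyl r s y) u))).
Proof.
  intros happ hr hN H.
  (* The Harnack inequality would give [1 - delta <= N * delta], but [(N + 1) * delta = 1/2]. *)
  set (delta := / (2 * (N + 1))).
  assert (dE : (N + 1) * delta = / 2) by (unfold delta; field; lra).
  assert (hd : 0 < delta) by (apply Rinv_0_lt_compat; lra).
  destruct (front_passes p a s y r delta happ hr) as [eps [u [he [Hu [B [H1 H2]]]]]]; [nra|].
  specialize (H eps u he Hu (fun t x h => proj1 (B t x h))).
  apply (Rbar_le_trans _ _ _ H2) in H.
  assert (P : cyl r s y (s - r ^ 2 / 2) y) by (unfold cyl; nra).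
  assert (I1 := Rbar_le_trans _ _ _ (inf_on_le _ u _ _ P)
                  (Rbar_le_trans _ _ _ (sup_on_ge _ u _ _ P) H1)).
  (* Together with [I1] this makes the infimum a real number. *)
  assert (I0 : Rbar_le 0 (inf_on (cyl r s y) u)).
  { apply inf_on_ge; intros t x h; apply B, (cyl_mono r); [lra | exact h]. }
  destruct (inf_on (cyl r s y) u) as [i| |]; simpl in *; try contradiction; nra.
Qed.

Theorem theorem4p2 (nu : R) (p a v : R -> R)
  (hnu : 0 < nu <= 1)
  (hp : smooth_periodic p) (ha : smooth_periodic a)
  (hp_bounds : forall x, nu <= p x <= / nu)
  (ha_bounds : forall x, nu <= a x <= / nu)
  (hv : smooth_periodic v) (hv_pos : forall x, 0 < v x)
  (hv_eq : forall x,
     Derive (fun z => p z * v z) x + Derive (fun z => a z * Derive v z) x = 0)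
  (hv_int : RInt v 0 1 = 1)
  (hb0 : RInt (fun x => Derive a x * v x) 0 1 <> 0) :
  (forall s y r : R, 0 < r ->
     (forall delta : R, 0 < delta < 1 ->
        exists (eps : R) (u : R -> R -> R),
          0 < eps /\
          solution p a eps (cyl r s y) u /\
          bounded_on (cyl r s y) u /\
          Rbar_lt 0 (osc (cyl r s y) u) /\
          Rbar_le (Rbar_mult (1 - delta) (osc (cyl r s y) u))
                  (osc (cyl (delta * r) s y) u)) /\
     ~ (exists alpha : R, 0 < alpha /\
          forall (eps : R) (u : R -> R -> R),
            0 < eps ->
            solution p a eps (cyl r s y) u ->
            bounded_on (cyl r s y) u ->
            forall rho : R, 0 < rho <= r ->
              Rbar_le (osc (cyl rho s y) u)
                      (Rbar_mult (Rpower (2 * rho / r) alpha)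
                                 (osc (cyl r s y) u))))
  /\
  (forall s y r : R, 0 < r ->
     (forall delta : R, 0 < delta < 1 ->
        exists (eps : R) (u : R -> R -> R),
          0 < eps /\
          solution p a eps (cyl (2 * r) s y) u /\
          (forall t x, cyl (2 * r) s y t x -> 0 <= u t x <= 1) /\
          Rbar_le (sup_on (cyl r s y) u) delta /\
          Rbar_le (1 - delta) (sup_on (cyl r (s - 2 * r ^ 2) y) u)) /\
     ~ (exists N : R, 1 < N /\
          forall (eps : R) (u : R -> R -> R),
            0 < eps ->
            solution p a eps (cyl (2 * r) s y) u ->
            (forall t x, cyl (2 * r) s y t x -> 0 <= u t x) ->
            Rbar_le (sup_on (cyl r (s - 2 * r ^ 2) y) u)
                    (Rbar_mult N (inf_on (cyl r s y) u)))).
Proof.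
  assert (happ : poly_approximable p a).
  { apply (nonzero_drift_approximable nu p a v); auto; [apply hnu | apply hp_bounds | apply ha_bounds]. }
  split; intros s y r hr; split.
  - intros delta hd; apply oscillation_persists; assumption.
  - intros [alpha [hal H]]; exact (no_uniform_holder p a s y r alpha happ hr hal H).
  - intros delta hd; apply front_passes; assumption.
  - intros [N [hN H]]; exact (no_uniform_harnack p a s y r N happ hr hN H).
Qed.
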